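(* Let $(X,d)$ be a b-metric space with coefficient $K_1\geqslant 1$ and let $(Y,\rho)$ be a b-metric space with coefficient $K_2\geqslant 1$. Let $\eta\colon[0,\infty)\to[0,\infty)$ be a homeomorphism and let $f\colon X\to Y$ be an $\eta$-quasisymmetry. Then $f$ maps bounded subspaces to bounded subspaces. Moreover, if $A\subseteq B\subseteq X$ with $0<\operatorname{diam} A$ and $\operatorname{diam} B<\infty$, then $\operatorname{diam} f(B)$ is finite and $$\frac{1}{2K_2\,\eta\left(\frac{\operatorname{diam} B}{\operatorname{diam} A}\right)}\leqslant \frac{\operatorname{diam} f(A)}{\operatorname{diam} f(B)}\leqslant \eta\left(\frac{2K_1\operatorname{diam} A}{\operatorname{diam} B}\right).$$
   Context: Write $\mathbb{R}^+=[0,\infty)$. A semimetric space is a set $X$ with a function $d\colon X\times X\to\mathbb{R}^+$ such that $d(x,y)=d(y,x)$ and $d(x,y)=0\Leftrightarrow x=y$ for all $x,y\in X$. A b-metric space with coefficient $K\geqslant 1$ is a semimetric space satisfying $d(x,y)\leqslant K(d(x,z)+d(z,y))$ for all $x,y,z\in X$. An embedding is an injective continuous mapping whose inverse, defined on the image, is continuous; continuity of a map $g$ between semimetric spaces means that $d(x_n,x)\to0$ implies that the distance between $g(x_n)$ and $g(x)$ tends to $0$. For semimetric spaces $(X,d)$, $(Y,\rho)$ and a homeomorphism $\eta\colon\mathbb{R}^+\to\mathbb{R}^+$, an embedding $f\colon X\to Y$ is an $\eta$-quasisymmetry if $d(x,a)\leqslant t\,d(x,b)$ implies $\rho(f(x),f(a))\leqslant\eta(t)\,\rho(f(x),f(b))$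 for all $a,b,x\in X$ and all $t\in\mathbb{R}^+$. The diameter of a subset $A$ of a semimetric space is $\operatorname{diam}A=\sup\{d(x,y)\colon x,y\in A\}$, and a set is bounded if its diameter is finite. *)

(* Defs.v *)
From HB Require Import structures.
From mathcomp Require Import all_boot all_order all_algebra.
From mathcomp Require Import all_classical all_reals all_analysis.

Set Implicit Arguments.
Unset Strict Implicit.
Unset Printing Implicit Defensive.

Import Order.TTheory GRing.Theory Num.Theory.
Import numFieldNormedType.Exports.

Local Open Scope classical_set_scope.
Local Open Scope ring_scope.

Section Semimetric.
Context {R : realType}.

Definition is_semimetric (X : Type) (d : X -> X -> R) : Prop :=
  [/\ forall x y, 0 <= d x y,
      forall x y, d x y = d y x &
      forall x y, d x y = 0 <-> x = y].

Definition is_b_metric (K : R) (X : Type) (d : X -> X -> R) : Prop :=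
  [/\ 1 <= K,
      is_semimetric d &
      forall x y z, d x y <= K * (d x z + d z y)].

Definition subdist (X : Type) (d : X -> X -> R) (A : set X) : A -> A -> R :=
  fun x y => d (\val x) (\val y).

Definition d_continuous (X Y : Type) (d : X -> X -> R) (rho : Y -> Y -> R)
    (g : X -> Y) : Prop :=
  forall (u : nat -> X) (x : X),
    (fun n => d (u n) x) @ \oo --> (0 : R) ->
    (fun n => rho (g (u n)) (g x)) @ \oo --> (0 : R).

Definition is_embedding (X Y : Type) (d : X -> X -> R) (rho : Y -> Y -> R)
    (f : X -> Y) : Prop :=
  [/\ injective f,
      d_continuous d rho f &
      exists g : range f -> X,
        (forall y : range f, f (g y) = \val y) /\
        d_continuous (subdist rho (A := range f)) d g].

(* A self-map of [0, +oo) is represented by a total function on R; its values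
   at negative arguments are irrelevant. *)
Definition is_homeo_Rplus (eta : R -> R) : Prop :=
  [/\ set_bij `[0, +oo[ `[0, +oo[ eta,
      {within `[0, +oo[, continuous eta} &
      exists theta : R -> R,
        {in `[0, +oo[, cancel eta theta} /\
        {within `[0, +oo[, continuous theta}].

Definition is_quasisymmetry (eta : R -> R) (X Y : Type) (d : X -> X -> R)
    (rho : Y -> Y -> R) (f : X -> Y) : Prop :=
  is_embedding d rho f /\
  forall (a b x : X) (t : R), 0 <= t ->
    d x a <= t * d x b -> rho (f x) (f a) <= eta t * rho (f x) (f b).

(* The supremum is taken in [0, +oo], so that the empty set has diameter 0. *)
Definition diam (X : Type) (d : X -> X -> R) (A : set X) : \bar R :=
  ereal_sup (0%E |` [set (d p.1 p.2)%:E | p in A `*` A]).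

Definition d_bounded (X : Type) (d : X -> X -> R) (A : set X) : Prop :=
  (diam d A < +oo)%E.

End Semimetric.

(* Main.v *)
Require Import Defs.
From HB Require Import structures.
From mathcomp Require Import all_boot all_order all_algebra.
From mathcomp Require Import all_classical all_reals all_analysis.
From mathcomp Require Import lra.

Set Implicit Arguments.
Unset Strict Implicit.
Unset Printing Implicit Defensive.

Import Order.TTheory GRing.Theory Num.Theory.
Import numFieldNormedType.Exports.

Local Open Scope classical_set_scope.
Local Open Scope ring_scope.

(** Both inequalities compare a fixed pair of points with a pair whose distance
    almost realizes a diameter.

    Lower bound.  If [a, a'] are points of [A], every [x] in [B] satisfies
    [d a x <= diam B = (diam B / d a a') * d a a'], so quasisymmetry puts [f B]
    in the ball of radius [eta (diam B / d a a') * rho (f a) (f a')] about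
    [f a], and such a ball has diameter at most [2 * K2] times its radius
    ([rho_image_le]).  For a single pair of distinct points this already gives
    the boundedness of images.  Letting [d a a'] tend to [diam A] gives
    [diam (f B) <= 2 * K2 * eta (diam B / diam A) * diam (f A)].

    Upper bound.  If [b, b'] are points of [B] and [a] is any point, one of
    [b, b'] lies at distance at least [d b b' / (2 * K1)] from [a], by the relaxed
    triangle inequality ([b_metric_far_point]).  Hence for [a, a'] in [A], the
    distance [d a a'] is at most [2 * K1 * diam A / d b b'] times [d a x] for some
    [x] in [B]; apply quasisymmetry and let [d b b'] tend to [diam B].

    Both limits have the same form ([le_homeo_limit]): the argument of [eta]
    is [c / s], where [s] approaches a positive number [L], and [eta] is
    continuous at [c / L]. *)

(** * Diameters *)

Section Diameter.
Context {R : realType}.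
Variables (X : Type) (d : X -> X -> R).
Implicit Types A B : set X.

Lemma diam_ge0 A : (0 <= diam d A)%E.
Proof. by apply: ereal_sup_ubound; left. Qed.

Lemma diam_le A (M : R) : 0 <= M ->
  (forall x y, A x -> A y -> d x y <= M) -> (diam d A <= M%:E)%E.
Proof.
move=> M0 AM; apply: ge_ereal_sup => _ [->|[[x y] [/= Ax Ay] <-]].
  by rewrite lee_fin.
by rewrite lee_fin; exact: AM.
Qed.

Lemma diam_subset A B : A `<=` B -> (diam d A <= diam d B)%E.
Proof.
move=> AB; apply: ereal_sup_le => _ [->|[[x y] [/= Ax Ay] <-]]; first by left.
by right; exists (x, y) => //; split; exact: AB.
Qed.

Lemma d_bounded_fin_num A : d_bounded d A -> diam d A \is a fin_num.
Proof. by move=> Aoo; rewrite ge0_fin_numE // diam_ge0. Qed.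

Lemma le_fine_diam A x y : d_bounded d A -> A x -> A y ->
  d x y <= fine (diam d A).
Proof.
move=> Aoo Ax Ay; rewrite -lee_fin fineK ?d_bounded_fin_num //.
by apply: ereal_sup_ubound; right; exists (x, y).
Qed.

(** The bound [r] has to be nonnegative because the empty set, which has no
    pair of points at all, has diameter [0]. *)
Lemma diam_gtP A (r : R) : 0 <= r -> (r%:E < diam d A)%E ->
  exists x y, [/\ A x, A y & r < d x y].
Proof.
move=> r0 /ereal_sup_gt[_ [->|[[x y] [/= Ax Ay] <-]]].
  by rewrite lte_fin ltNge r0.
by rewrite lte_fin => rxy; exists x, y.
Qed.

Lemma fine_diam_approx A (e : R) : d_bounded d A -> (0 < diam d A)%E -> 0 < e ->
  exists x y, [/\ A x, A y, 0 < d x y & fine (diam d A) - e < d x y].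
Proof.
move=> Aoo A0 e0; have Afin := d_bounded_fin_num Aoo.
have [||x [y [Ax Ay]]] := @diam_gtP A (Num.max 0 (fine (diam d A) - e)).
- by rewrite le_max lexx.
- rewrite -(fineK Afin) lte_fin gt_max ltrBlDr ltrDl e0 andbT.
  by rewrite -lte_fin fineK.
by rewrite gt_max => /andP[xy0 xye]; exists x, y.
Qed.

End Diameter.

(** In a b-metric space no point is close to both ends of a long segment. *)
Lemma b_metric_far_point (R : realType) (X : Type) (d : X -> X -> R) (K : R)
    (B : set X) (a x y : X) : is_b_metric K d -> B x -> B y ->
  exists2 z, B z & d x y <= 2 * K * d a z.
Proof.
move=> [K1 [_ dC _] tri] Bx By.
have xy : d x y <= K * (d a x + d a y) by rewrite (dC a x); exact: tri.
have [axy|ayx] := leP (d a x) (d a y).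
- by exists y => //; nra.
- by exists x => //; nra.
Qed.

(** * Homeomorphisms of the half-line *)

Section Homeomorphism.
Context {R : realType}.
Variable eta : R -> R.
Hypothesis heta : is_homeo_Rplus eta.

Lemma homeo_Rplus_ge0 q : 0 <= q -> 0 <= eta q.
Proof.
case: heta => -[+ _ _] _ _ q0 => /(_ q).
by rewrite /= !in_itv/= !andbT; exact.
Qed.

Lemma homeo_Rplus_continuous_at q : 0 < q -> {for q, continuous eta}.
Proof.
case: heta => _ ceta _ q0.
have : {within `]0, +oo[, continuous eta}.
  apply: continuous_subspaceW ceta => z /=.
  by rewrite !in_itv/= !andbT; exact: ltW.
rewrite continuous_open_subspace; last exact: interval_open.
by apply; rewrite inE/= in_itv/= q0.
Qed.

(** Passage to the limit along distances [s] that approach a diameter [L]. *)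
Lemma le_homeo_limit (c L m M : R) : 0 < c -> 0 < L ->
  (forall e, 0 < e ->
     exists s, [/\ L - e < s, s <= L & m <= eta (c / s) * M]) ->
  m <= eta (c / L) * M.
Proof.
move=> c0 L0 approx; rewrite leNgt; apply/negP => ltm.
have cont : eta (c / s) * M @[s --> L] --> eta (c / L) * M.
  apply: cvgM; last exact: cvg_cst.
  apply: (@cvg_comp _ _ _ (fun s => c / s) eta _ (nbhs (c / L))).
    by apply: cvgM; [exact: cvg_cst|apply: cvgV => //; rewrite gt_eqF].
  by apply: homeo_Rplus_continuous_at; rewrite divr_gt0.
have : nbhs L [set s | eta (c / s) * M < m] by exact: cvgr_lt cont _ ltm.
move=> /nbhs_ballP[e /= e0 Le].
have [s [Les sL]] := approx e e0.
apply/negP; rewrite -ltNge; apply: Le.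
by rewrite /ball/= ger0_norm ?subr_ge0// ltrBlDr addrC -ltrBlDr.
Qed.

End Homeomorphism.

(** * Images under quasisymmetries *)

Section Quasisymmetry.
Context {R : realType}.
Variables (X Y : Type) (K1 K2 : R) (d : X -> X -> R) (rho : Y -> Y -> R).
Variables (eta : R -> R) (f : X -> Y).
Hypothesis hd : is_b_metric K1 d.
Hypothesis hrho : is_b_metric K2 rho.
Hypothesis heta : is_homeo_Rplus eta.
Hypothesis hf : is_quasisymmetry eta d rho f.

(** The image of a ball of radius [D] about [a] lies in a ball about [f a];
    its radius is measured by any reference point [a'] other than [a]. *)
Lemma rho_image_le (D : R) (a a' x y : X) : 0 < d a a' -> 0 <= D ->
  d a x <= D -> d a y <= D ->
  rho (f x) (f y) <= 2 * K2 * (eta (D / d a a') * rho (f a) (f a')).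
Proof.
move=> aa0 D0 ax ay.
have [K21 [_ rC _] tri] := hrho.
have radius z : d a z <= D ->
    rho (f a) (f z) <= eta (D / d a a') * rho (f a) (f a').
  move=> az; apply: hf.2; first by rewrite divr_ge0 // ltW.
  by rewrite divfK ?gt_eqF.
have := tri (f x) (f y) (f a); rewrite (rC (f x) (f a)) => /le_trans; apply.
rewrite -mulrA mulrCA ler_wpM2l ?(le_trans ler01) //.
by rewrite mulr_natl mulr2n lerD // radius.
Qed.

Lemma quasisymmetry_bounded (A : set X) :
  d_bounded d A -> d_bounded rho (f @` A).
Proof.
move=> Aoo; have [_ [d0 _ dE] _] := hd; have [K21 [r0 _ rE] _] := hrho.
have [[a [a' [Aa Aa' aa']]]|triv] :=
  pselect (exists a a', [/\ A a, A a' & a <> a']).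
- have aa0 : 0 < d a a' by rewrite lt_neqAle d0 andbT eq_sym; apply/eqP => /dE.
  have D0 : 0 <= fine (diam d A) by rewrite fine_ge0 // diam_ge0.
  apply: (le_lt_trans (@diam_le _ _ rho _
    (2 * K2 * (eta (fine (diam d A) / d a a') * rho (f a) (f a'))) _ _)).
  + rewrite !mulr_ge0 ?(le_trans ler01 K21) //.
    by apply: homeo_Rplus_ge0 => //; rewrite divr_ge0.
  + move=> _ _ [x Ax <-] [y Ay <-].
    by apply: rho_image_le => //; exact: le_fine_diam.
  + exact: ltry.
- apply: (le_lt_trans (@diam_le _ _ rho _ 0 _ _)); rewrite ?ltry //.
  move=> _ _ [x Ax <-] [y Ay <-]; suff -> : x = y by rewrite (rE _ _).2.
  by apply: contrapT => xy; apply: triv; exists x, y.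
Qed.

Lemma quasisymmetry_diam_gt0 (A : set X) :
  (0 < diam d A)%E -> (0 < diam rho (f @` A))%E.
Proof.
move=> /(diam_gtP (lexx 0))[x [y [Ax Ay xy0]]].
have [_ [_ _ dE] _] := hd; have [_ [r0 _ rE] _] := hrho.
have [[finj _ _] _] := hf.
suff fxy0 : 0 < rho (f x) (f y).
  apply: (@lt_le_trans _ _ (rho (f x) (f y))%:E); first by rewrite lte_fin.
  apply: ereal_sup_ubound; right; exists (f x, f y) => //=.
  by split; [exists x|exists y].
rewrite lt_neqAle r0 andbT eq_sym; apply/eqP => /rE/finj/dE xy.
by rewrite xy ltxx in xy0.
Qed.

Variables A B : set X.
Hypothesis AB : A `<=` B.
Hypothesis A0 : (0 < diam d A)%E.
Hypothesis Boo : d_bounded d B.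

Let dA := fine (diam d A).
Let dB := fine (diam d B).
Let dfA := fine (diam rho (f @` A)).
Let dfB := fine (diam rho (f @` B)).

Let Aoo : d_bounded d A.
Proof. exact: le_lt_trans (diam_subset d AB) Boo. Qed.

Let B0 : (0 < diam d B)%E.
Proof. exact: lt_le_trans A0 (diam_subset d AB). Qed.

Let dA0 : 0 < dA.
Proof. by rewrite fine_gt0 // A0. Qed.

Let dB0 : 0 < dB.
Proof. by rewrite fine_gt0 // B0. Qed.

Let rho_le_dfA x y : A x -> A y -> rho (f x) (f y) <= dfA.
Proof.
move=> Ax Ay; apply: le_fine_diam; [exact: quasisymmetry_bounded| |].
- by exists x.
- by exists y.
Qed.

Let rho_le_dfB x y : B x -> B y -> rho (f x) (f y) <= dfB.
Proof.
move=> Bx By; apply: le_fine_diam; [exact: quasisymmetry_bounded| |].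
- by exists x.
- by exists y.
Qed.

Lemma diam_image_le_subset : dfB <= eta (dB / dA) * (2 * K2 * dfA).
Proof.
have [K21 _ _] := hrho; have K20 : 0 <= 2 * K2 by lra.
apply: le_homeo_limit => // e e0.
have [a [a' [Aa Aa' aa0 aae]]] := fine_diam_approx Aoo A0 e0.
exists (d a a'); split => //; first exact: le_fine_diam.
have eta0 : 0 <= eta (dB / d a a').
  by apply: homeo_Rplus_ge0 => //; rewrite divr_ge0 // ltW.
have dfA0 : 0 <= dfA by rewrite fine_ge0 // diam_ge0.
rewrite -lee_fin fineK; last first.
  by apply: d_bounded_fin_num; exact: quasisymmetry_bounded.
apply: diam_le; first by rewrite mulr_ge0 // mulr_ge0.
move=> _ _ [x Bx <-] [y By <-].
have Ba := AB Aa.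
apply: le_trans (rho_image_le aa0 (ltW dB0) (le_fine_diam Boo Ba Bx)
  (le_fine_diam Boo Ba By)) _.
by rewrite [leRHS]mulrCA !ler_wpM2l // rho_le_dfA.
Qed.

Lemma diam_image_le_superset : dfA <= eta (2 * K1 * dA / dB) * dfB.
Proof.
have [K11 [dge0 _ _] _] := hd; have K10 : 0 < 2 * K1 by lra.
apply: le_homeo_limit => //; first exact: mulr_gt0.
move=> e e0.
have [b [b' [Bb Bb' bb0 bbe]]] := fine_diam_approx Boo B0 e0.
exists (d b b'); split => //; first exact: le_fine_diam.
have t0 : 0 <= 2 * K1 * dA / d b b'.
  by rewrite ltW // divr_gt0 // mulr_gt0.
have eta0 : 0 <= eta (2 * K1 * dA / d b b') by exact: homeo_Rplus_ge0.
have dfB0 : 0 <= dfB by rewrite fine_ge0 // diam_ge0.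
rewrite -lee_fin fineK; last first.
  by apply: d_bounded_fin_num; exact: quasisymmetry_bounded.
apply: diam_le; first exact: mulr_ge0.
move=> _ _ [a Aa <-] [a' Aa' <-].
have [x Bx far] := b_metric_far_point a hd Bb Bb'.
apply: (@le_trans _ _ (eta (2 * K1 * dA / d b b') * rho (f a) (f x))).
  apply: hf.2 => //; apply: (le_trans (le_fine_diam Aoo Aa Aa')).
  rewrite mulrAC ler_pdivlMr // -/dA (mulrC _ dA) -mulrA.
  by rewrite ler_pM2l.
by rewrite ler_wpM2l // rho_le_dfB //; exact: AB.
Qed.

Lemma quasisymmetry_diam_ratio :
  1 / (2 * K2 * eta (dB / dA)) <= dfA / dfB <= eta (2 * K1 * dA / dB).
Proof.
have [K21 _ _] := hrho; have K20 : 0 < 2 * K2 by lra.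
have dfB0 : 0 < dfB.
  rewrite fine_gt0 // quasisymmetry_diam_gt0 //=.
  exact: quasisymmetry_bounded.
have dfA0 : 0 <= dfA by rewrite fine_ge0 // diam_ge0.
apply/andP; split; last first.
  by rewrite ler_pdivrMr //; exact: diam_image_le_superset.
have low := diam_image_le_subset.
(* The estimate itself excludes a vanishing value of eta, since the image of B
   has positive diameter. *)
have eta0 : 0 < eta (dB / dA).
  rewrite lt_neqAle homeo_Rplus_ge0 ?divr_ge0 ?ltW // andbT.
  apply/eqP => eta0; move: low.
  by rewrite -eta0 mul0r leNgt dfB0.
rewrite ler_pdivrMr ?(mulr_gt0 K20) // mulrAC ler_pdivlMr // mul1r.
by apply: le_trans low _; rewrite mulrCA mulrA mulrC.
Qed.

End Quasisymmetry.

Theorem theorem2p1 (R : realType) (X Y : Type) (K1 K2 : R)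
    (d : X -> X -> R) (rho : Y -> Y -> R) (eta : R -> R) (f : X -> Y)
    (hd : is_b_metric K1 d) (hrho : is_b_metric K2 rho)
    (heta : is_homeo_Rplus eta) (hf : is_quasisymmetry eta d rho f) :
  (forall A : set X, d_bounded d A -> d_bounded rho (f @` A)) /\
  (forall A B : set X, A `<=` B ->
     (0 < diam d A)%E -> (diam d B < +oo)%E ->
     (diam rho (f @` B) < +oo)%E /\
     1 / (2 * K2 * eta (fine (diam d B) / fine (diam d A)))
       <= fine (diam rho (f @` A)) / fine (diam rho (f @` B))
       <= eta (2 * K1 * fine (diam d A) / fine (diam d B))).
Proof.
split=> [A|A B AB A0 Boo]; first exact: quasisymmetry_bounded hd hrho heta hf A.
split; first exact: quasisymmetry_bounded hd hrho heta hf B Boo.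
exact: quasisymmetry_diam_ratio.
Qed.
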